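(* Let $k$ be a positive integer and $S=\langle 4k+5,4k+7,4k+11,4k+13\rangle$. Then \[\mathrm{Ap}(S,4k+5)=\{a(4k+7)+b(4k+11)+c(4k+13)\mid (a,b,c)\in C\},\] where $C=C_a\cup C_b\cup C_c$ with $C_a=\big(\{1\}\times\{0\}\times\{0,1,\dots,k\}\big)\cup\{(2,0,0)\}$, $C_b=\big(\{0\}\times\{1,2\}\times\{0,1,\dots,k\}\big)\setminus\{(0,2,k)\}$, and $C_c=\{0\}\times\{0\}\times\{0,1,\dots,k+1\}$.
   Context: $\mathbb{N}=\{0,1,2,\dots\}$. For $X\subseteq\mathbb{N}$, $\langle X\rangle$ is the submonoid of $(\mathbb{N},+)$ generated by $X$; here it is a numerical semigroup. For a numerical semigroup $S$ and $n\in S\setminus\{0\}$, the Apéry set is $\mathrm{Ap}(S,n)=\{s\in S\mid s-n\notin S\}$. *)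

(* Defs.v *)
From mathcomp Require Import all_boot.
From mathcomp Require Import boolp classical_sets.

Set Implicit Arguments.
Unset Strict Implicit.
Unset Printing Implicit Defensive.

Local Open Scope classical_set_scope.

Definition submonoid (M : set nat) : Prop :=
  M 0 /\ forall x y, M x -> M y -> M (x + y).

Definition monoid_span (X : set nat) : set nat := smallest submonoid X.

(* The difference s - n is meant in the integers, whereas subtraction on nat
   truncates at 0; hence the guard n <= s. The definition is total; it is meant
   for S a numerical semigroup and n a nonzero element of S. *)
Definition Apery (S : set nat) (n : nat) : set nat :=
  [set s | S s /\ ~ (n <= s /\ S (s - n))].

Definition Ca (k : nat) : set (nat * nat * nat) :=
  ([set 1] `*` [set 0] `*` [set c | c <= k]) `|` [set (2, 0, 0)].

Definition Cb (k : nat) : set (nat * nat * nat) :=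
  ([set 0] `*` [set 1; 2] `*` [set c | c <= k]) `\` [set (0, 2, k)].

Definition Cc (k : nat) : set (nat * nat * nat) :=
  [set 0] `*` [set 0] `*` [set c | c <= k.+1].

Definition C (k : nat) : set (nat * nat * nat) := Ca k `|` Cb k `|` Cc k.

(* Main.v *)
Require Import Defs.
From mathcomp Require Import all_boot.
From mathcomp Require Import boolp classical_sets.
From mathcomp Require Import zify.

(** Put [m = 4k+5], so that the generators are [m + 2u] with [u] in
    [{0,1,3,4}].  A sum of [N] generators is [N m + 2t] where [t] is a sum of at
    most [N] terms from [{1,3,4}]; this is possible iff [t <= 4N], except for
    [N = 1], [t = 2].  As [m] is odd, [2t] runs through the residues mod [m] for
    [t < m], and the Apéry element of the class of [2t] is [N m + 2t] with [N]
    the least number of terms summing to [t].  The set [C] lists one optimal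
    decomposition [t = a + 3b + 4c] for each [t < m]. *)

Local Open Scope classical_set_scope.

Lemma monoid_span4P (p q r s n : nat) :
  monoid_span [set p; q; r; s] n <->
  exists d a b c, n = d * p + a * q + b * r + c * s.
Proof.
split.
- move=> /(_ [set n | exists d a b c, n = d * p + a * q + b * r + c * s]).
  apply; split.
  + split; first by exists 0, 0, 0, 0.
    move=> _ _ [d [a [b [c ->]]]] [d' [a' [b' [c' ->]]]].
    exists (d + d'), (a + a'), (b + b'), (c + c').
    rewrite !mulnDl; lia.
  + move=> _ [[[->|->]|->]|->].
    * by exists 1, 0, 0, 0; lia.
    * by exists 0, 1, 0, 0; lia.
    * by exists 0, 0, 1, 0; lia.
    * by exists 0, 0, 0, 1; lia.
- move=> [d [a [b [c ->]]]] M [[M0 MD] XM].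
  have MM x e : M x -> M (e * x).
    by move=> Mx; elim: e => // e IHe; rewrite mulSn; exact: MD.
  by apply: (MD); [apply: (MD); [apply: (MD)|]|];
    apply: MM; apply: XM; rewrite /=; tauto.
Qed.

Definition coin_sum (N t : nat) : Prop := t <= 4 * N /\ ~ (N = 1 /\ t = 2).

(** Greedy payment: use fours, settle the remainder mod 4, and fill up with zeros. Remainder 2 is
    paid by breaking a four, [4 + 2 = 3 + 3]; without a four, [t = 2] costs two ones. *)
Lemma coin_sumP (N t : nat) :
  coin_sum N t <->
  exists d a b c, N = d + a + b + c /\ t = a + 3 * b + 4 * c.
Proof.
split=> [[tN Nt]|[d [a [b [c [-> ->]]]]]]; last by split; lia.
have [t2|t2] := eqVneq t 2; first by exists (N - 2), 2, 0, 0; lia.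
have tE := divn_eq t 4; have := ltn_pmod t (isT : 0 < 4).
move: (t %/ 4) (t %% 4) tE => q [|[|[|[|//]]]] tE _.
- by exists (N - q), 0, 0, q; lia.
- by exists (N - q.+1), 1, 0, q; lia.
- by exists (N - q.+1), 0, 2, q.-1; lia.
- by exists (N - q.+1), 0, 1, q; lia.
Qed.

Lemma span_coin_sumP (m n : nat) :
  monoid_span [set m; m + 2; m + 6; m + 8] n <->
  exists N t, coin_sum N t /\ n = N * m + 2 * t.
Proof.
rewrite monoid_span4P; split.
- move=> [d [a [b [c ->]]]].
  exists (d + a + b + c), (a + 3 * b + 4 * c); split; last by lia.
  by apply/coin_sumP; exists d, a, b, c.
- move=> [N [t [/coin_sumP[d [a [b [c [-> ->]]]]] ->]]].
  by exists d, a, b, c; lia.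
Qed.

Lemma Apery_coin_sumP (m n : nat) : odd m -> 2 < m ->
  Apery (monoid_span [set m; m + 2; m + 6; m + 8]) m n <->
  exists N t, [/\ coin_sum N t, t < m, n = N * m + 2 * t &
                  forall N', coin_sum N' t -> N <= N'].
Proof.
move=> m_odd m_gt2; split.
- move=> [/span_coin_sumP[N [t [Nt ->]]] nS]; exists N, t.
  (* If [m <= t], two more copies of [m] can be split off [2 * t]; removing one leaves
     [N.+1 * m + 2 * (t - m)], still in the semigroup. *)
  have tm : t < m.
    rewrite ltnNge; apply/negP => mt; apply: nS; split; first by lia.
    apply/span_coin_sumP; exists N.+1, (t - m).
    by case: Nt => tN N1; split; [split; lia|rewrite mulSn; lia].
  split=> // N' N't; rewrite leqNgt; apply/negP => N'N.
  have NmE : N * m = m + N.-1 * m by rewrite -mulSn prednK //; lia.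
  rewrite NmE -addnA leq_addr addKn in nS; apply: nS; split=> //.
  apply/span_coin_sumP; exists N.-1, t; split=> //.
  by case: N't Nt => tN' N1' [tN N1]; split; lia.
- move=> [N [t [Nt tm -> Nmin]]].
  split; first by apply/span_coin_sumP; exists N, t.
  move=> [mn /span_coin_sumP[N' [t' [N't' nE]]]].
  have {}nE : N * m + 2 * t = N'.+1 * m + 2 * t' by rewrite mulSn; lia.
  have [N'N|NN'] := ltnP N' N.
    have tt' : t <= t' by nia.
    suff /Nmin : coin_sum N' t by lia.
    case: N't' => tN' N1'; split; first by lia.
    (* In the exceptional case [2 = 1 + 1] bounds [N] by 2; then [t' = t = 2], which is excluded for
       [N' = 1]. *)
    move=> [N'1 t2]; apply: N1'; split=> //.
    have N2 : N = 2.
      have : N <= 2 by apply: Nmin; split; lia.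
      by lia.
    by move: nE; rewrite N2 N'1 t2; lia.
  (* Here [2 * t = (N'.+1 - N) * m + 2 * t']: a coefficient of at least 2 contradicts [t < m], and
     coefficient 1 contradicts [m] odd. *)
  have [NN|ne_NN'] := eqVneq N N'; last by nia.
  by move: nE; rewrite NN mulSn; lia.
Qed.

Lemma CP (k a b c : nat) :
  C k (a, b, c) <->
  [\/ [/\ a = 1, b = 0 & c <= k] \/ [/\ a = 2, b = 0 & c = 0],
      [/\ a = 0, b = 1 & c <= k] \/ [/\ a = 0, b = 2 & c < k] |
      [/\ a = 0, b = 0 & c <= k.+1]].
Proof.
split.
- case=> [[[[[/= -> ->] ck]|[-> -> ->]]|[[[/= ->] bE ck] ne]]|[[/= -> ->] ck]].
  + by apply: Or31; left.
  + by apply: Or31; right.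
  + apply: Or32; case: bE => bE; rewrite /= in bE ck; first by left.
    right; split=> //; rewrite ltn_neqAle ck andbT.
    by apply/eqP => cE; apply: ne; rewrite /= bE cE.
  + exact: Or33.
- case=> [[[-> -> ck]|[-> -> ->]]|[[-> -> ck]|[-> -> ck]]|[-> -> ck]].
  + by left; left; left.
  + by left; left; right.
  + by left; right; split; [split=> //; split=> //; left|case].
  + left; right; split.
      by split; [split=> //; right|exact: ltnW].
    by case=> cE; rewrite cE ltnn in ck.
  + by right.
Qed.

Theorem theorem24 (k : nat) (hk : 0 < k) :
  Apery (monoid_span [set 4 * k + 5; 4 * k + 7; 4 * k + 11; 4 * k + 13])
        (4 * k + 5)
  = [set n | exists a b c : nat, C k (a, b, c) /\
       n = a * (4 * k + 7) + b * (4 * k + 11) + c * (4 * k + 13)].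
Proof.
have [-> -> ->] : [/\ 4 * k + 7 = 4 * k + 5 + 2, 4 * k + 11 = 4 * k + 5 + 6 &
                      4 * k + 13 = 4 * k + 5 + 8] by split; lia.
have m_odd : odd (4 * k + 5) by lia.
have m_gt2 : 2 < 4 * k + 5 by lia.
have [m mE] : exists m, m = 4 * k + 5 by eexists.
rewrite -mE in m_odd m_gt2 *.
apply/seteqP; split=> n /=; rewrite Apery_coin_sumP //.
- move=> [N [t [/coin_sumP[d [a [b [c [NE tE]]]]] tm -> Nmin]]].
  have [t2|t2] := eqVneq t 2.
    have N2 : N <= 2 by apply: Nmin; split; lia.
    exists 2, 0, 0; split; first by apply/CP; apply: Or31; right.
    have -> : N = 2 by lia.
    by lia.
  have Nlow : t <= 4 * N by lia.
  (* Away from [t = 2], the least [N] is the ceiling of [t / 4]. *)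
  have Nup q : t <= 4 * q -> N <= q by move=> tq; apply: Nmin; split; lia.
  have {}tE := divn_eq t 4; have := ltn_pmod t (isT : 0 < 4).
  move: (t %/ 4) (t %% 4) tE => q [|[|[|[|//]]]] tE _.
  (* As [t <= 4 * k + 4], [q] is at most [k.+1] for remainder 0 and at most [k] otherwise. Remainder
     2 has only [q.-1] fours, hence no [(0, 2, k)] in [C]. *)
  + have -> : N = q by have := Nup q; lia.
    by exists 0, 0, q; split; [apply/CP; apply: Or33; split|]; lia.
  + have -> : N = q.+1 by have := Nup q.+1; lia.
    by exists 1, 0, q; split; [apply/CP; apply: Or31; left; split|]; lia.
  + have -> : N = q.-1.+2 by have := Nup q.+1; lia.
    by exists 0, 2, q.-1; split; [apply/CP; apply: Or32; right; split|]; lia.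
  + have -> : N = q.+1 by have := Nup q.+1; lia.
    by exists 0, 1, q; split; [apply/CP; apply: Or32; left; split|]; lia.
- move=> [a [b [c [/CP abcC ->]]]].
  exists (a + b + c), (a + 3 * b + 4 * c); split; [| |lia|].
  + by apply/coin_sumP; exists 0, a, b, c.
  + by case: abcC => [[]|[]|] [? ? ?]; lia.
  (* [tN'] suffices for every triple but [(2, 0, 0)], where [N1'] rules out [N' = 1]. *)
  + by move=> N' [tN' N1']; case: abcC => [[]|[]|] [? ? ?]; lia.
Qed.
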